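(* Let $G$ be a bipartite graph whose reduced adjacency matrix $M$ has real rank $3$. Then: (1) $3 \leq bp(G) \leq 4$ and $2 \leq bc(G) \leq 4$. (2) $bp(G) = bc(G) = 4$ if and only if the kernel of $G$ has a cycle of length $8$ as a subgraph. (3) $bp(G) = bc(G)$ unless the kernel of $G$ is a cycle of length $6$ with a chord bisecting the cycle. (4) The kernel of $G$ has at most $4$ vertices on one of its sides.
   Context: For a bipartite graph $G$ with $n$ and $m$ vertices on its two sides, its reduced adjacency matrix is the $n\times m$ $0,1$ matrix $M$ with $M_{i,j} = 1$ if and only if $(i,j)$ is an edge of $G$, where $i$ indexes the vertices of the first side and $j$ those of the second side. The real rank of $M$ is its usual rank over $\mathbb{R}$. The biclique partition number $bp(G)$ (respectively, biclique cover number $bc(G)$) is the minimum number of bicliques (complete bipartite subgraphs) of $G$ needed to partition (respectively, cover) all edges of $G$. The kernel of $G$ is the subgraph of $G$ obtained by removing all vertices with no neighbors, and removing all vertices but one from any set of vertices with the same neighbor set.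
   Formalization: In (2), ''cycle of length 8 as a subgraph'' is taken to mean an induced (chordless) 8-cycle; with chords allowed the claim fails, e.g. for the rank-3 matrix with rows 0011, 1100, 1111, 0101, which has an 8-cycle but bp = 3. *)

(* Defs.v *)
(* MathComp; [reals] is used only for the field of real numbers. *)
From mathcomp Require Import all_boot all_order all_algebra.
From mathcomp Require Import reals.

Set Implicit Arguments.
Unset Strict Implicit.
Unset Printing Implicit Defensive.

Definition bigraph (n m : nat) := 'I_n -> 'I_m -> bool.

Definition reduced_adj (R : realType) n m (G : bigraph n m) : 'M[R]_(n, m) :=
  (\matrix_(i < n, j < m) (G i j)%:R)%R.

(* A biclique is given by its two sides; as for K_{s,t} with s, t >= 1, neither
   side is empty. *)
Definition biclique n m (G : bigraph n m) (K : {set 'I_n} * {set 'I_m}) :=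
  [&& K.1 != set0, K.2 != set0 & [forall i in K.1, forall j in K.2, G i j]].

Definition bicliques_through n m (F : {set {set 'I_n} * {set 'I_m}}) i j :=
  [set K in F | (i \in K.1) && (j \in K.2)].

Definition biclique_cover n m (G : bigraph n m)
    (F : {set {set 'I_n} * {set 'I_m}}) :=
  [forall K in F, biclique G K] &&
  [forall i, forall j, G i j ==> (0 < #|bicliques_through F i j|)].

Definition biclique_partition n m (G : bigraph n m)
    (F : {set {set 'I_n} * {set 'I_m}}) :=
  [forall K in F, biclique G K] &&
  [forall i, forall j, G i j ==> (#|bicliques_through F i j| == 1)].

Lemma biclique_partition_cover n m (G : bigraph n m) F :
  biclique_partition G F -> biclique_cover G F.
Proof.
case/andP=> bF /forallP pF; rewrite /biclique_cover bF; apply/forallP=> i.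
by apply/forallP=> j; apply/implyP=> Gij; rewrite (eqP (implyP (forallP (pF i) j) Gij)).
Qed.

Lemma biclique_partition_edges n m (G : bigraph n m) :
  biclique_partition G [set ([set p.1], [set p.2]) | p in [pred p | G p.1 p.2]].
Proof.
apply/andP; split.
  apply/forall_inP=> _ /imsetP[[i j] /= Gij ->]; apply/and3P.
  split; try by apply/set0Pn; eexists; apply: set11.
  by apply/forall_inP=> _ /set1P->; apply/forall_inP=> _ /set1P->.
apply/forallP=> i; apply/forallP=> j; apply/implyP=> Gij; apply/cards1P.
exists ([set i], [set j]); apply/setP=> K; rewrite !inE.
apply/andP/eqP=> [[/imsetP[[a b] _ ->]]|->] /=.
  by rewrite !inE => /andP[/eqP-> /eqP->].
by rewrite !set11; split=> //; apply/imsetP; exists (i, j).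
Qed.

Lemma ex_biclique_partition n m (G : bigraph n m) :
  exists k, [exists F, biclique_partition G F && (#|F| == k)].
Proof.
eexists; apply/existsP; eexists; apply/andP; split=> //.
exact: biclique_partition_edges.
Qed.

Lemma ex_biclique_cover n m (G : bigraph n m) :
  exists k, [exists F, biclique_cover G F && (#|F| == k)].
Proof.
case: (ex_biclique_partition G) => k /existsP[F /andP[pF cF]].
by exists k; apply/existsP; exists F; rewrite biclique_partition_cover.
Qed.

Definition bp n m (G : bigraph n m) : nat := ex_minn (ex_biclique_partition G).
Definition bc n m (G : bigraph n m) : nat := ex_minn (ex_biclique_cover G).

Definition adj n m (G : bigraph n m) : rel ('I_n + 'I_m) := fun u v =>
  match u, v with
  | inl i, inr j | inr j, inl i => G i j
  | _, _ => false
  end.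

Definition neighbors n m (G : bigraph n m) v : {set 'I_n + 'I_m} :=
  [set w | adj G v w].

Definition non_isolated n m (G : bigraph n m) : {set 'I_n + 'I_m} :=
  [set v | neighbors G v != set0].

(* A kernel is represented by its vertex set [V] (it is an induced subgraph):
   exactly one vertex of each class of non-isolated vertices with the same
   neighbor set. It depends on the choice of these vertices, but only up to
   isomorphism. *)
Definition is_kernel n m (G : bigraph n m) (V : {set 'I_n + 'I_m}) :=
  is_transversal V (preim_partition (neighbors G) (non_isolated G))
    (non_isolated G).

Lemma is_kernel_exists n m (G : bigraph n m) : exists V, is_kernel G V.
Proof. by eexists; apply: transversalP; apply: preim_partitionP. Qed.

Definition cycle_rel k : rel 'I_k := fun a b => (b == ordS a) || (a == ordS b).

(* The cycle 0, 1, 2, 3, 4, 5 together with the chord joining 0 and 3. *)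
Definition bisected_hexagon : rel 'I_6 := fun a b =>
  cycle_rel a b || ((nat_of_ord a, nat_of_ord b) \in [:: (0, 3); (3, 0)]).

Definition induced_copy n m (G : bigraph n m) k (H : rel 'I_k)
    (f : 'I_k -> 'I_n + 'I_m) :=
  injective f /\ forall a b, adj G (f a) (f b) = H a b.

(* A cycle as a subgraph is taken to be an induced (chordless) one. With chords
   allowed, an 8-cycle would not force four bicliques: the graph with rows
   0011, 1100, 1111, 0101 has real rank 3, is its own kernel and has a
   Hamiltonian 8-cycle, but its edges are partitioned by the three bicliques
   {1,3} x {3,4}, {2,3} x {1,2} and {4} x {2,4}. *)
Definition has_induced_cycle n m (G : bigraph n m) (V : {set 'I_n + 'I_m}) (k : nat) :=
  exists2 f : 'I_k -> 'I_n + 'I_m,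
    induced_copy G (@cycle_rel k) f & forall a, f a \in V.

Definition is_bisected_hexagon n m (G : bigraph n m) (V : {set 'I_n + 'I_m}) :=
  exists2 f : 'I_6 -> 'I_n + 'I_m,
    induced_copy G bisected_hexagon f & f @: [set: 'I_6] = V.

Definition left_side n m (V : {set 'I_n + 'I_m}) : {set 'I_n} :=
  [set i | inl i \in V].

Definition right_side n m (V : {set 'I_n + 'I_m}) : {set 'I_m} :=
  [set j | inr j \in V].

(* Main.v *)
Require Import Defs.
From mathcomp Require Import all_boot all_order all_algebra.
From mathcomp Require Import reals.
From mathcomp Require Import zify lra.

(** Why the theorem holds.

    The distinct nonzero columns of the matrix [M] of [G] (its column kernel)
    and the distinct nonzero rows carry all the information: [bp G] is at most
    the number of kernel vertices on either side, by taking stars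
    ([bp_le_columns]). A partition into [k] bicliques factors [M] through
    dimension [k], so [3 <= bp G] ([rank_le_bp]), and a cover by one biclique
    is a partition, so [2 <= bc G] ([bp_le_bc]).

    Fix three kernel columns that span the column space ([kernel_basis]). A row
    becomes a vertex of the cube [{0,1}^3], and distinct nonzero rows become
    distinct nonzero vertices; a column becomes a linear form with values in
    [{0,1}] on these vertices. Together with the origin, four rows give five of
    the eight vertices, hence both ends of an edge in every direction, so the
    coefficients of all these forms lie in [{-1,0,1}] ([cube_coefficient]).
    With five rows, the six vertices leave room for at most one form besides
    the three coordinates ([unique_extra_form]). So one side of the kernel has
    at most four vertices, and [bp G <= 4].

    Suppose now that [3 < bp G]. Then some side, say the columns, has exactly
    four kernel vertices, the other at least four, and the dependency between
    the four columns equates the sums of two disjoint sets of columns. If one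
    set is a singleton, that column is a disjoint union of others and three
    stars suffice once enlarged ([bp_lt_columns]). Otherwise [a + b = c + d];
    the nonzero rows are among 1010, 1001, 0110, 0101 and 1111, and if one of
    the first four is absent three bicliques suffice again
    ([bp_le3_missing_row]), while if all are present they form an induced
    8-cycle. Conversely, alternate edges of an induced 8-cycle lie in different
    bicliques, so [4 <= bc G] ([octagon_bc]). Hence [bp G = 4] exactly when the
    kernel has an induced 8-cycle, and then [bc G = 4] too.

    When [bp G = 3], the two numbers differ only if [bc G = 2]. Then vertices
    are classified by which of the two bicliques contain them, and since either
    side has at least three kernel vertices every type occurs exactly once in
    the kernel, which is therefore the bisected hexagon
    ([bc2_bisected_hexagon]). *)

Set Implicit Arguments.
Unset Strict Implicit.
Unset Printing Implicit Defensive.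

Import GRing.Theory Num.Theory.

(** * Biclique partitions and covers as decompositions of the matrix *)

Definition transpose n m (G : bigraph n m) : bigraph m n := fun j i => G i j.

(** Pieces with an empty side contain no edge and are discarded; the others are
    pairwise distinct because every edge is counted once. *)
Lemma bp_le n m (G : bigraph n m) (T : finType) (D : {set T})
    (A : T -> {set 'I_n}) (B : T -> {set 'I_m}) :
    (forall i j, \sum_(t in D) ((i \in A t) && (j \in B t)) = G i j) ->
  bp G <= #|D|.
Proof.
move=> sumG.
pose F := [set K in [set (A t, B t) | t in D] | (K.1 != set0) && (K.2 != set0)].
suff pF : biclique_partition G F.
  rewrite /bp; case: ex_minnP => k _ /(_ #|F|) le_k.
  apply: leq_trans (leq_imset_card (fun t => (A t, B t)) D).
  apply: leq_trans (le_k _) (subset_leq_card _).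
    by apply/existsP; exists F; rewrite pF eqxx.
  by apply/subsetP=> K; rewrite inE => /andP[].
apply/andP; split.
  apply/forall_inP=> K; rewrite inE => /andP[/imsetP[t Dt ->] /andP[A0 B0]].
  apply/and3P; split=> //; apply/forall_inP=> i Ai; apply/forall_inP=> j Bj.
  by move: (sumG i j); rewrite (bigD1 t) //= Ai Bj; case: (G i j).
apply/forallP=> i; apply/forallP=> j; apply/implyP=> Gij.
move: (sumG i j); rewrite Gij => /eqP/sum_nat_eq1[t [Dt]].
case: (boolP (_ && _)) => // /andP[Ai Bj] _ t_uniq.
apply/cards1P; exists (A t, B t); apply/setP=> K; rewrite !inE.
apply/andP/eqP=> [[/andP[/imsetP[s Ds ->] _] /andP[Ais Bjs]] | -> /=].
  have [-> // | neq_st] := eqVneq s t.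
  by move: (t_uniq s neq_st Ds); rewrite Ais Bjs.
rewrite Ai Bj (imset_f (fun t => (A t, B t))) //=; split=> //.
by apply/andP; split; apply/set0Pn; [exists i | exists j].
Qed.

Lemma bp_partition n m (G : bigraph n m) :
  exists2 F : {set {set 'I_n} * {set 'I_m}}, #|F| = bp G &
    forall i j, \sum_(K in F) ((i \in K.1) && (j \in K.2)) = G i j.
Proof.
rewrite /bp; case: ex_minnP => k /existsP[F /andP[/andP[bF pF] /eqP cF]] _.
exists F => // i j; case Gij: (G i j).
  move/forallP/(_ i)/forallP/(_ j): pF; rewrite Gij => /eqP c1.
  rewrite -[RHS]c1 -sum1_card big_mkcond [RHS]big_mkcond; apply: eq_bigr => K _.
  by rewrite /bicliques_through inE; case: (K \in F) => //=; case: (_ && _).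
apply: big1 => K FK; case: (boolP (_ && _)) => // /andP[Ki Kj].
case/and3P: (forall_inP bF K FK) => _ _ /forall_inP/(_ i Ki)/forall_inP/(_ j Kj).
by rewrite Gij.
Qed.

Lemma bc_cover n m (G : bigraph n m) :
  exists2 F : {set {set 'I_n} * {set 'I_m}}, #|F| = bc G &
    forall i j, G i j = [exists K in F, (i \in K.1) && (j \in K.2)].
Proof.
rewrite /bc; case: ex_minnP => k /existsP[F /andP[/andP[bF cF] /eqP kF]] _.
exists F => // i j; apply/idP/exists_inP=> [Gij | [K FK /andP[Ki Kj]]].
  move/forallP/(_ i)/forallP/(_ j)/implyP/(_ Gij)/card_gt0P: cF => [K].
  by rewrite inE => /andP[FK ?]; exists K.
case/and3P: (forall_inP bF K FK) => _ _.
by move=> /forall_inP/(_ i Ki)/forall_inP/(_ j Kj).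
Qed.

Lemma bc_le_bp n m (G : bigraph n m) : bc G <= bp G.
Proof.
rewrite /bp; case: ex_minnP => k /existsP[F /andP[pF kF]] _.
rewrite /bc; case: ex_minnP => l _; apply.
by apply/existsP; exists F; rewrite biclique_partition_cover.
Qed.

(** A single biclique cannot overlap another one, so a cover by at most one
    biclique is a partition. *)
Lemma bp_le_bc n m (G : bigraph n m) : bc G <= 1 -> bp G <= bc G.
Proof.
have [F <- FG] := bc_cover G; move=> /card_le1_eqP F_eq.
apply: (@bp_le _ _ _ _ F fst snd) => i j; rewrite FG.
case: exists_inP => [[K FK /andP[Ki Kj]] | noK].
  rewrite (bigD1 K) //= Ki Kj big1 // => K' /andP[FK'].
  by rewrite (F_eq K' K) ?eqxx.
by apply: big1 => K FK; case: (boolP (_ && _)) => // ?; case: noK; exists K.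
Qed.

Lemma bp_transpose n m (G : bigraph n m) : bp (transpose G) = bp G.
Proof.
have bp_tr_le a b (H : bigraph a b) : bp (transpose H) <= bp H.
  have [F <- FH] := bp_partition H.
  apply: (@bp_le _ _ _ _ F snd fst) => j i; rewrite -FH.
  by apply: eq_bigr => K _; rewrite andbC.
by apply/eqP; rewrite eqn_leq bp_tr_le (bp_tr_le _ _ (transpose G)).
Qed.

(** A partition into [k] bicliques writes the matrix as a sum of [k] matrices
    of rank one, that is as a product of an [n * k] and a [k * m] matrix. *)
Lemma rank_le_bp (R : realType) n m (G : bigraph n m) :
  \rank (reduced_adj R G) <= bp G.
Proof.
have [F <- FG] := bp_partition G.
pose X : 'M[R]_(n, #|F|) := (\matrix_(i, t) (i \in (@enum_val _ (mem F) t).1)%:R)%R.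
pose Y : 'M[R]_(#|F|, m) := (\matrix_(t, j) (j \in (@enum_val _ (mem F) t).2)%:R)%R.
suff ->: reduced_adj R G = (X *m Y)%R by apply: mulmx_max_rank.
apply/matrixP=> i j; rewrite !mxE -FG natr_sum big_enum_val.
by apply: eq_bigr => t _; rewrite !mxE -natrM mulnb.
Qed.

Lemma rank_transpose (R : realType) n m (G : bigraph n m) :
  \rank (reduced_adj R (transpose G)) = \rank (reduced_adj R G).
Proof.
by rewrite -mxrank_tr; congr (\rank _); apply/matrixP=> i j; rewrite !mxE.
Qed.

(** * The kernel, one side at a time *)

(** The part of a kernel on the second side; the part on the first side is the
    column kernel of the transpose. *)
Definition column_kernel n m (G : bigraph n m) (C : {set 'I_m}) :=
  [/\ forall j, j \in C -> exists i, G i j,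
      {in C &, forall j j', (forall i, G i j = G i j') -> j = j'}
    & forall i j, G i j -> exists2 j', j' \in C & forall i', G i' j = G i' j'].

(** Every nonempty column has a copy in the column kernel, so a partition of
    the edges meeting the column kernel extends to one of all edges. *)
Lemma bp_le_kernel n m (G : bigraph n m) (C : {set 'I_m}) (T : finType)
    (D : {set T}) (A : T -> {set 'I_n}) (B : T -> {set 'I_m}) :
    column_kernel G C ->
    (forall i j, j \in C ->
       \sum_(t in D) ((i \in A t) && (j \in B t)) = G i j) ->
  bp G <= #|D|.
Proof.
case=> _ _ copyG sumG.
pose copy j := [pick j' in C | [forall i, G i j == G i j']].
pose B' t := [set j | if copy j is Some j' then j' \in B t else false].
apply: (@bp_le _ _ _ _ D A B') => i j.
transitivity (\sum_(t in D) ((i \in A t) &&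
    if copy j is Some j' then j' \in B t else false)).
  by apply: eq_bigr => t _; rewrite inE.
rewrite /copy; case: pickP => [j' /andP[Cj' /forallP eqj] | nocopy].
  by rewrite sumG // (eqP (eqj i)).
rewrite big1 => [|t _]; last by rewrite andbF.
case Gij: (G i j) => //; have [j' Cj' eqj] := copyG i j Gij.
by case/andP: (nocopy j'); split=> //; apply/forallP=> i'; rewrite eqj.
Qed.

(** The stars centred in the column kernel. *)
Lemma bp_le_columns n m (G : bigraph n m) (C : {set 'I_m}) :
  column_kernel G C -> bp G <= #|C|.
Proof.
move=> kerC; apply: (@bp_le_kernel _ _ _ _ _ C (fun t => [set i | G i t])
  (fun t => [set t]) kerC) => i j Cj.
rewrite (bigD1 j) //= !inE eqxx andbT big1 ?addn0 // => t /andP[_ neq_tj].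
by rewrite !inE eq_sym (negPf neq_tj) andbF.
Qed.

(** A column that is the sum of others is the disjoint union of their supports:
    it is covered by enlarging the stars of its summands. *)
Lemma bp_lt_columns n m (G : bigraph n m) (C : {set 'I_m}) k (S : {set 'I_m}) :
    column_kernel G C -> k \in C -> S \subset C :\ k ->
    (forall i, \sum_(t in S) G i t = G i k) ->
  bp G < #|C|.
Proof.
move=> kerC Ck sSC sumS; rewrite (cardsD1 k C) Ck add1n ltnS.
apply: (@bp_le_kernel _ _ _ _ _ (C :\ k) (fun t => [set i | G i t])
  (fun t => if t \in S then [set t; k] else [set t]) kerC) => i j Cj.
have [-> | neq_jk] := eqVneq j k.
  rewrite -sumS; transitivity (\sum_(t in C :\ k | t \in S) G i t).
    rewrite big_mkcondr /=; apply: eq_bigr => t; rewrite !inE => /andP[neq_tk _].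
    case: (t \in S); rewrite !inE ?eqxx ?orbT ?andbT //.
    by rewrite eq_sym (negPf neq_tk) andbF.
  by apply: eq_bigl => t; apply: andb_idl; apply: (subsetP sSC).
rewrite (bigD1 j) /=; last by rewrite !inE neq_jk.
rewrite (_ : j \in _ = true); last by case: ifP => _; rewrite !inE eqxx.
rewrite inE andbT big1 ?addn0 // => t /andP[_ neq_tj].
case: (boolP (_ && _)) => // /andP[_].
by case: ifP => _; rewrite !inE eq_sym (negPf neq_tj) ?(negPf neq_jk).
Qed.

Lemma kernelP n m (G : bigraph n m) (V : {set 'I_n + 'I_m}) :
    is_kernel G V ->
  [/\ {in V, forall v, neighbors G v != set0},
      {in V &, injective (neighbors G)}
    & forall v, neighbors G v != set0 ->
        exists2 u, u \in V & neighbors G u = neighbors G v].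
Proof.
case/and3P=> _ sub /forall_inP tr.
have block v : neighbors G v != set0 ->
    #|V :&: [set y in non_isolated G | neighbors G v == neighbors G y]| == 1.
  by move=> nv; apply: tr; apply: imset_f; rewrite inE.
have nonisol : {in V, forall v, neighbors G v != set0}.
  by move=> v /(subsetP sub); rewrite inE.
split=> // [u v Vu Vv eq_uv | v /block/cards1P[u /setP/(_ u)]].
  have [w /setP Ew] := cards1P (block u (nonisol u Vu)).
  have := Ew u; have := Ew v.
  by rewrite !inE eq_uv eqxx Vu Vv nonisol //= => /esym/eqP-> /esym/eqP->.
by rewrite !inE eqxx => /and3P[Vu _ /eqP->]; exists u.
Qed.

Lemma neighbors_eqP n m (G : bigraph n m) u v :
  neighbors G u = neighbors G v <-> forall w, adj G u w = adj G v w.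
Proof.
split=> [/setP E w | E]; first by have := E w; rewrite !inE.
by apply/setP=> w; rewrite !inE E.
Qed.

Lemma right_side_kernel n m (G : bigraph n m) (V : {set 'I_n + 'I_m}) :
  is_kernel G V -> column_kernel G (right_side V).
Proof.
case/kernelP=> nonisol inj rep; split=> [j | j j' | i j Gij].
- rewrite inE => /nonisol/set0Pn[[i|j']]; rewrite inE //= => Gij.
  by exists i.
- rewrite !inE => Vj Vj' Ejj'; apply: inr_inj; apply: inj => //.
  by apply/neighbors_eqP=> -[i|//]; apply: Ejj'.
have [|[i'|j'] Vj /neighbors_eqP E] := rep (inr j).
- by apply/set0Pn; exists (inl i); rewrite inE.
- by have := E (inl i); rewrite /= Gij.
by exists j' => [|i']; [rewrite inE | have /= <- := E (inl i')].
Qed.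

Lemma left_side_kernel n m (G : bigraph n m) (V : {set 'I_n + 'I_m}) :
  is_kernel G V -> column_kernel (transpose G) (left_side V).
Proof.
case/kernelP=> nonisol inj rep; split=> [i | i i' | j i Gij].
- rewrite inE => /nonisol/set0Pn[[i'|j]]; rewrite inE //= => Gij.
  by exists j.
- rewrite !inE => Vi Vi' Eii'; apply: inl_inj; apply: inj => //.
  by apply/neighbors_eqP=> -[//|j]; apply: Eii'.
have [|[i'|j'] Vi /neighbors_eqP E] := rep (inl i).
- by apply/set0Pn; exists (inr j); rewrite inE.
- by exists i' => [|j']; [rewrite inE | have := E (inr j')].
by have := E (inr j); rewrite /= [G i j]Gij.
Qed.

(** * Induced 8-cycles need four bicliques *)

(** The cycle [y 0, x 0, y 3, x 3, y 2, x 2, y 1, x 1], with its two sides kept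
    apart. *)
Definition octagon n m (G : bigraph n m) (x : 'I_4 -> 'I_n) (y : 'I_4 -> 'I_m) :=
  forall a b, G (x a) (y b) = (a == b) || (a == ordS b).

(** Edges, no two of which fit in one biclique, need different bicliques. *)
Lemma fooling_set_le_bc n m (G : bigraph n m) k
    (x : 'I_k -> 'I_n) (y : 'I_k -> 'I_m) :
    (forall a, G (x a) (y a)) ->
    (forall a b, a != b -> ~~ (G (x a) (y b) && G (x b) (y a))) ->
  k <= bc G.
Proof.
move=> edge cross; have [F <- FG] := bc_cover G.
have /fin_all_exists2[K FK xyK] : forall a, exists2 K, K \in F &
    (x a \in K.1) && (y a \in K.2).
  by move=> a; apply/exists_inP; rewrite -FG.
have K_inj : injective K.
  move=> a b eqK; apply: contraTeq isT => /cross; apply: contraNN => _.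
  case/andP: (xyK a) (xyK b) => xa ya; rewrite -eqK => /andP[xb yb].
  by rewrite !FG; apply/andP; split; apply/exists_inP; exists (K a) => //;
    apply/andP.
rewrite -[k]card_ord -(card_imset _ K_inj); apply: subset_leq_card.
by apply/subsetP=> _ /imsetP[a _ ->].
Qed.

Lemma octagon_bc n m (G : bigraph n m) x y : octagon G x y -> 4 <= bc G.
Proof.
move=> oct; apply: (@fooling_set_le_bc _ _ G 4 x y) => [a | a b].
  by rewrite oct eqxx.
by rewrite !oct; case: a b => [[|[|[|[|a]]]] lta] [[|[|[|[|b]]]] ltb].
Qed.

Lemma octagon_transpose n m (G : bigraph n m) x y :
  octagon (transpose G) x y -> octagon G (y \o @ord_pred 4) x.
Proof.
move=> oct a b; rewrite /= -[G _ _]/(transpose G _ _) oct.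
by case: a b => [[|[|[|[|a]]]] lta] [[|[|[|[|b]]]] ltb].
Qed.

Lemma cycle8_twin_free (u v : 'I_8) :
  (forall w, cycle_rel u w = cycle_rel v w) -> u = v.
Proof.
move=> E; have := E (ordS u); have := E (ord_pred u); clear E.
rewrite /cycle_rel eqxx ord_predK eqxx orbT => /esym H1 /esym H2; apply/eqP.
apply: contraTT H1.
case: v u H2 => [[|[|[|[|[|[|[|[|v]]]]]]]] ltv] //;
by case=> [[|[|[|[|[|[|[|[|u]]]]]]]] ltu].
Qed.

Lemma octagonP n m (G : bigraph n m) (V : {set 'I_n + 'I_m}) :
  has_induced_cycle G V 8 <->
  exists x y, [/\ octagon G x y, forall a, x a \in left_side V
                & forall b, y b \in right_side V].
Proof.
split=> [[f [_ adjf] Vf] | [x [y [oct Vx Vy]]]]; last first.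
  pose half (u : 'I_8) : 'I_4 := inord u./2.
  pose f (u : 'I_8) : 'I_n + 'I_m :=
    if odd u then inr (y (half u)) else inl (x (half u)).
  have valh u : half u = u./2 :> nat.
    by rewrite inordK //; case: u => [[|[|[|[|[|[|[|[|u]]]]]]]] ltu].
  have adjf u v : adj G (f u) (f v) = cycle_rel u v.
    rewrite /f; case: ifP => odd_u; case: ifP => odd_v;
      rewrite /= ?oct /cycle_rel -!val_eqE /= ?valh; move: odd_u odd_v;
      case: v => [[|[|[|[|[|[|[|[|v]]]]]]]] ltv] //;
      by case: u => [[|[|[|[|[|[|[|[|u]]]]]]]] ltu].
  exists f => [|u]; last first.
    rewrite /f; case: ifP => _.
      by have := Vy (half u); rewrite inE.
    by have := Vx (half u); rewrite inE.
  split=> // u v eq_f; apply: cycle8_twin_free => w.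
  by rewrite -!adjf eq_f.
(* The sides alternate along the cycle, but the first vertex may lie on either
     side; in the second case the columns are shifted by one step. *)
pose side (v : 'I_n + 'I_m) := if v is inl _ then true else false.
have sidef k : k < 8 -> side (f (inord k)) = odd k (+) side (f ord0).
  elim: k => [_ | k IH ltk]; first by congr (side (f _)); apply/val_inj; rewrite /= inordK.
  have := adjf (inord k) (inord k.+1).
  rewrite /cycle_rel -[_ == ordS _]val_eqE /= !inordK ?(ltnW ltk) //.
  rewrite modn_small // eqxx /= addNb -(IH (ltnW ltk)).
  by case: (f _) (f _) => [?|?] [].
have inlP k : k < 8 -> odd k (+) side (f ord0) -> exists i, f (inord k) = inl i.
  by move=> /sidef <-; case: (f _) => // i _; exists i.
have inrP k : k < 8 -> ~~ (odd k (+) side (f ord0)) -> exists j, f (inord k) = inr j.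
  by move=> /sidef <-; case: (f _) => // j _; exists j.
have even_lt (a : 'I_4) : a.*2 < 8 by case: a => [[|[|[|[|a]]]] lta].
have odd_lt (a : 'I_4) : a.*2.+1 < 8 by case: a => [[|[|[|[|a]]]] lta].
case s0: (side (f ord0)) in inlP inrP.
  have /fin_all_exists[x Ex] (a : 'I_4) : exists i, f (inord a.*2) = inl i.
    by apply: inlP; rewrite ?even_lt // odd_double.
  have /fin_all_exists[y Ey] (b : 'I_4) : exists j, f (inord b.*2.+1) = inr j.
    by apply: inrP; rewrite ?odd_lt //= odd_double.
  exists x, y; split=> [a b | a | b]; rewrite ?inE -?Ex -?Ey //.
  have := adjf (inord a.*2) (inord b.*2.+1); rewrite Ex Ey /= => ->.
  rewrite /cycle_rel -!val_eqE /= !inordK //.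
  by case: a b => [[|[|[|[|a]]]] lta] [[|[|[|[|b]]]] ltb].
have /fin_all_exists[x Ex] (a : 'I_4) : exists i, f (inord a.*2.+1) = inl i.
  by apply: inlP; rewrite ?odd_lt //= odd_double.
have /fin_all_exists[y Ey] (b : 'I_4) : exists j, f (inord b.*2) = inr j.
  by apply: inrP; rewrite ?even_lt // odd_double.
exists x, (y \o @ordS 4); split=> [a b | a | b]; rewrite ?inE -?Ex -?Ey //.
have := adjf (inord a.*2.+1) (inord (ordS b).*2); rewrite Ex Ey /= => ->.
rewrite /cycle_rel -!val_eqE /= !inordK ?(even_lt (ordS b)) //.
by case: a b => [[|[|[|[|a]]]] lta] [[|[|[|[|b]]]] ltb].
Qed.

(** * Graphs covered by two bicliques *)

(** When two bicliques cover the edges, a column is determined by which of them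
    contain it, which leaves three types of nonzero columns. If one of them were
    missing, two stars would partition the edges. *)
Lemma column_types n m (G : bigraph n m) (C : {set 'I_m})
    (r : 'I_n -> bool * bool) (c : 'I_m -> bool * bool) :
    (forall i j, G i j = (r i).1 && (c j).1 || (r i).2 && (c j).2) ->
    column_kernel G C -> 2 < bp G ->
  {in C &, injective c} /\ c @: C = [set~ (false, false)].
Proof.
move=> GE kerC bpG; have [nonzero inj _] := kerC.
have c_inj : {in C &, injective c}.
  by move=> j j' Cj Cj' eq_c; apply: inj => // i; rewrite !GE eq_c.
split=> //; apply/eqP; rewrite eqEcard cardsC1 card_prod card_bool card_in_imset //.
rewrite (leq_trans bpG (bp_le_columns kerC)) andbT; apply/subsetP=> _ /imsetP[j Cj ->].
have [i] := nonzero j Cj; rewrite GE !inE.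
by case: (c j) => -[] []; rewrite /= ?andbF.
Qed.

Lemma bisected_hexagon_twin_free (u v : 'I_6) :
  (forall w, bisected_hexagon u w = bisected_hexagon v w) -> u = v.
Proof.
move=> E; have {E}Ek k ltk := E (@Ordinal 6 k ltk).
have := (Ek 0 isT, Ek 1 isT, Ek 2 isT, Ek 3 isT, Ek 4 isT, Ek 5 isT); clear Ek.
move=> E; apply/eqP; apply: contraTT isT; move: E.
case: u => [[|[|[|[|[|[|u]]]]]] ltu] //;
by case: v => [[|[|[|[|[|[|v]]]]]] ltv] // [[[[[]]]]].
Qed.

Lemma bc2_bisected_hexagon n m (G : bigraph n m) V :
  is_kernel G V -> 2 < bp G -> bc G = 2 -> is_bisected_hexagon G V.
Proof.
move=> kerV bpG bcG; have [F /eqP] := bc_cover G.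
rewrite bcG => /cards2P[K [K' [_ ->]]] FG.
pose r i := (i \in K.1, i \in K'.1); pose c j := (j \in K.2, j \in K'.2).
have {FG}GE i j : G i j = (r i).1 && (c j).1 || (r i).2 && (c j).2.
  rewrite FG; apply/exists_inP/orP => [[L /set2P[]-> ->]|[]]; auto.
    by exists K => //; rewrite !inE eqxx.
  by exists K' => //; rewrite !inE eqxx orbT.
have [c_inj imc] := column_types GE (right_side_kernel kerV) bpG.
have [r_inj imr] : {in left_side V &, injective r} /\
    r @: left_side V = [set~ (false, false)].
  apply: (@column_types _ _ (transpose G) _ c r) (left_side_kernel kerV) _.
    by move=> j i; rewrite /transpose GE andbC [(r i).2 && _]andbC.
  by rewrite bp_transpose.
have row z : z != (false, false) -> exists2 i, i \in left_side V & r i = z.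
  by move=> nz; have /imsetP[i Vi ->] : z \in r @: left_side V; [rewrite imr !inE | exists i].
have col z : z != (false, false) -> exists2 j, j \in right_side V & c j = z.
  by move=> nz; have /imsetP[i Vi ->] : z \in c @: right_side V; [rewrite imc !inE | exists i].
have [x0 Vx0 rx0] := row (true, true) isT; have [y0 Vy0 cy0] := col (true, true) isT.
have [x1 Vx1 rx1] := row (true, false) isT; have [y1 Vy1 cy1] := col (true, false) isT.
have [x2 Vx2 rx2] := row (false, true) isT; have [y2 Vy2 cy2] := col (false, true) isT.
pose s := [:: inl x0; inr y1; inl x1; inr y0; inl x2; inr y2] : seq ('I_n + 'I_m).
pose f (u : 'I_6) := nth (inl x0) s u.
have adjf u v : adj G (f u) (f v) = bisected_hexagon u v.
  case: u => [[|[|[|[|[|[|u]]]]]] ltu] //;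
  by case: v => [[|[|[|[|[|[|v]]]]]] ltv] //; rewrite /= GE ?rx0 ?rx1 ?rx2 ?cy0 ?cy1 ?cy2.
exists f.
  split=> // u v eq_f; apply: bisected_hexagon_twin_free => w.
  by rewrite -!adjf eq_f.
have mem_s v : v \in s -> v \in f @: [set: 'I_6].
  move=> s_v; have lt6 : index v s < 6 by rewrite (index_mem v s).
  by apply/imsetP; exists (Ordinal lt6); rewrite // /f nth_index.
apply/setP=> v; apply/idP/idP=> [/imsetP[u _ ->]|Vv].
  have s_fu : f u \in s by apply: mem_nth; apply: ltn_ord.
  suff /allP/(_ _ s_fu) : all [in V] s by [].
  by move: Vx0 Vx1 Vx2 Vy0 Vy1 Vy2; rewrite !inE /= => -> -> -> -> -> ->.
apply: mem_s; case: v Vv => [i | j] Vv; rewrite !inE /=.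
  have Vi : i \in left_side V by rewrite inE.
  have : r i \in [set~ (false, false)] by rewrite -imr imset_f.
  rewrite !inE; case ri: (r i) => [[] []] // _.
  - by rewrite (r_inj i x0) ?eqxx ?rx0.
  - by rewrite (r_inj i x1) ?eqxx ?orbT ?rx1.
  - by rewrite (r_inj i x2) ?eqxx ?orbT ?rx2.
have Vj : j \in right_side V by rewrite inE.
have : c j \in [set~ (false, false)] by rewrite -imc imset_f.
rewrite !inE; case cj: (c j) => [[] []] // _.
- by rewrite (c_inj j y0) ?eqxx ?orbT ?cy0.
- by rewrite (c_inj j y1) ?eqxx ?orbT ?cy1.
- by rewrite (c_inj j y2) ?eqxx ?orbT ?cy2.
Qed.

(** * Rows as cube vertices, columns as linear forms *)

Lemma natr_bool_inj (R : numDomainType) (v w : bool) :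
  (v%:R = w%:R :> R)%R -> v = w.
Proof. by move/eqP; rewrite eqr_nat; case: v w => [] []. Qed.

Lemma kernel_basis (R : realType) n m (G : bigraph n m) (C : {set 'I_m}) r :
    column_kernel G C -> \rank (reduced_adj R G) = r ->
  exists (b : 'I_r -> 'I_m) (alpha : 'I_m -> 'I_r -> R),
    [/\ injective b, forall t, b t \in C
      & forall i j, ((G i j)%:R = \sum_t alpha j t * (G i (b t))%:R)%R].
Proof.
set M := reduced_adj R G => kerC; rewrite -mxrank_tr => <-.
set e := maxrankfun M^T%R.
have free : row_free (rowsub e M^T%R) := maxrowsub_free _.
have erow t i : row t (rowsub e M^T%R) ord0 i = ((G i (e t))%:R)%R by rewrite !mxE.
have e_nonzero t : exists i, G i (e t).
  apply/existsP; apply: contraT; rewrite negb_exists => /forallP e0.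
  suff /(congr1 (fun v : 'rV[R]__ => v ord0 t))/eqP : delta_mx ord0 t = 0%R :> 'rV[R]__.
    by rewrite !mxE !eqxx oner_eq0.
  apply: (row_free_inj free); rewrite -rowE mul0mx; apply/rowP=> i.
  by rewrite erow (negPf (e0 i)) mxE.
have e_inj s t : (forall i, G i (e s) = G i (e t)) -> s = t.
  move=> est; have : delta_mx ord0 s = delta_mx ord0 t :> 'rV[R]__.
    by apply: (row_free_inj free); rewrite -!rowE; apply/rowP=> i; rewrite !erow est.
  move=> /(congr1 (fun v : 'rV[R]__ => v ord0 s))/eqP; rewrite !mxE !eqxx /=.
  by case: (s =P t) => // _; rewrite oner_eq0.
have [nonzero inj copy] := kerC.
have /fin_all_exists2[b Cb eb] t : exists2 j, j \in C & forall i, G i (e t) = G i j.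
  by have [i /copy] := e_nonzero t.
have : (M^T%R <= rowsub e M^T%R)%MS by rewrite eq_maxrowsub.
case/submxP=> alpha MT; exists b, alpha; split=> [s t eq_b | // | i j].
  by apply: e_inj => i; rewrite !eb eq_b.
have /matrixP/(_ j i) := MT; rewrite !mxE => ->.
by apply: eq_bigr => t _; rewrite !mxE eb.
Qed.

Definition flip r (t : 'I_r) (p : {ffun 'I_r -> bool}) : {ffun 'I_r -> bool} :=
  [ffun s => (s == t) (+) p s].

(** More than half of the vertices of a cube include both ends of some edge in
    each direction. Along such an edge a linear form changes by the
    corresponding coefficient. *)
Lemma cube_coefficient (R : numDomainType) r (alpha : 'I_r -> R)
    (P : {set {ffun 'I_r -> bool}}) :
    2 ^ r < 2 * #|P| ->
    (forall p, p \in P -> exists v : bool, (\sum_t alpha t * (p t)%:R = v%:R)%R) ->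
  forall t, exists2 c : int, c \in [:: -1; 0; 1]%R & alpha t = (c%:~R)%R.
Proof.
move=> bigP valP t.
have flipK : involutive (flip t).
  by move=> p; apply/ffunP=> s; rewrite !ffunE addbA addbb.
have /set0Pn[p] : P :&: flip t @: P != set0.
  apply: contraTneq bigP => disjP; rewrite -leqNgt mul2n -addnn.
  rewrite -{2}(card_imset _ (inv_inj flipK)) -cardsUI disjP cards0 addn0.
  by rewrite (leq_trans (max_card _)) // card_ffun card_bool card_ord.
wlog pt : p / p t.
  move=> wl; case pt : (p t); first exact: wl.
  move=> /setIP[Pp /imsetP[q Pq Ep]]; apply: (wl q).
    by move: pt; rewrite Ep ffunE eqxx; case: (q t).
  by rewrite inE Pq; apply/imsetP; exists p; rewrite // Ep flipK.
move=> /setIP[Pp /imsetP[q Pq Ep]].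
have [[v Ev] [w Ew]] := (valP p Pp, valP q Pq).
have qt : q t = false by move: pt; rewrite Ep ffunE eqxx; case: (q t).
have alphaE : (alpha t = v%:R - w%:R)%R.
  rewrite -Ev -Ew (bigD1 t) //= [X in (_ - X)%R](bigD1 t) //= pt qt.
  rewrite mulr1 mulr0 add0r (eq_bigr (fun s => (alpha s * (q s)%:R)%R)) ?addrK //.
  by move=> s /negPf neq_st; rewrite Ep ffunE neq_st.
exists (v%:R - w%:R)%R; first by case: v w {Ev Ew alphaE} => [] [].
by rewrite alphaE rmorphB /= !natz.
Qed.

(** Distinct nonzero rows have distinct nonzero restrictions to a column basis;
    the origin, where every form vanishes, is one more cube vertex. *)
Lemma row_patterns (R : realType) n m (G : bigraph n m) (L : {set 'I_n}) r
    (b : 'I_r -> 'I_m) (alpha : 'I_m -> 'I_r -> R) :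
    column_kernel (transpose G) L ->
    (forall i j, ((G i j)%:R = \sum_t alpha j t * (G i (b t))%:R)%R) ->
  exists2 P : {set {ffun 'I_r -> bool}}, #|P| = #|L|.+1 &
    forall j p, p \in P -> exists v : bool, (\sum_t alpha j t * (p t)%:R = v%:R)%R.
Proof.
case=> nonzero inj _ GE; pose pat i := [ffun t => G i (b t)].
have patE i j : ((G i j)%:R = \sum_t alpha j t * (pat i t)%:R)%R.
  by rewrite GE; apply: eq_bigr => t _; rewrite ffunE.
have pat0 i : i \in L -> pat i != [ffun=> false].
  case/nonzero=> j Gij; apply: contraTneq Gij => pat0; rewrite /transpose.
  suff /(@natr_bool_inj _ _ false)-> : ((G i j)%:R = 0%:R :> R)%R by [].
  by rewrite patE pat0 big1 // => t _; rewrite ffunE mulr0.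
have pat_inj : {in L &, injective pat}.
  move=> i i' Li Li' eq_pat; apply: inj => // j; rewrite /transpose.
  by apply: (@natr_bool_inj R); rewrite !patE eq_pat.
exists ([ffun=> false] |: pat @: L) => [|j p].
  rewrite cardsU1 card_in_imset // (_ : _ \notin _ = true) //.
  by apply/imsetP=> -[i Li /esym/eqP]; apply/negP/pat0.
case/setU1P=> [-> | /imsetP[i _ ->]]; last by exists (G i j).
by exists false; rewrite big1 // => t _; rewrite ffunE mulr0.
Qed.

Lemma small_coefficients (R : realType) n m (G : bigraph n m) L
    (b : 'I_3 -> 'I_m) (alpha : 'I_m -> 'I_3 -> R) :
    column_kernel (transpose G) L -> 3 < #|L| ->
    (forall i j, ((G i j)%:R = \sum_t alpha j t * (G i (b t))%:R)%R) ->
  forall j t, exists2 c : int, c \in [:: -1; 0; 1]%R & alpha j t = (c%:~R)%R.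
Proof.
move=> kerL L4 GE j; have [P cardP PE] := row_patterns kerL GE.
by apply: (cube_coefficient (P := P)) (PE j); rewrite cardP; lia.
Qed.

(** * A side of the kernel with at most four vertices *)

Definition linear_form (f : int * int * int) (p : bool * bool * bool) : int :=
  (f.1.1 *+ p.1.1 + f.1.2 *+ p.1.2 + f.2 *+ p.2)%R.

Definition triples T (s : seq T) : seq (T * T * T) :=
  [seq (x, z) | x <- [seq (x, y) | x <- s, y <- s], z <- s].

Definition zero_one_on (f : int * int * int) : pred (bool * bool * bool) :=
  fun p => linear_form f p \in [:: 0; 1]%R.

Definition coordinate_forms : seq (int * int * int) :=
  [:: (1, 0, 0); (0, 1, 0); (0, 0, 1)]%R.

(** A nonzero form with coefficients in [{-1,0,1}] that is not a coordinate
    has a value outside [{0,1}] at two or more of the eight vertices, and for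
    two different such forms these vertices are not the same two. *)
Lemma unique_extra_form :
  all (fun f => all (fun g =>
     [|| f == (0, 0, 0)%R, g == (0, 0, 0)%R, f \in coordinate_forms,
         g \in coordinate_forms, f == g |
         count (predI (zero_one_on f) (zero_one_on g)) (triples [:: false; true]) <= 5])
    (triples [:: -1; 0; 1]%R)) (triples [:: -1; 0; 1]%R).
Proof. by vm_compute. Qed.

Lemma column_kernel_le4 (R : realType) n m (G : bigraph n m)
    (L : {set 'I_n}) (C : {set 'I_m}) :
    \rank (reduced_adj R G) = 3 -> column_kernel (transpose G) L ->
    column_kernel G C ->
  4 < #|L| -> #|C| <= 4.
Proof.
move=> rk kerL kerC L5.
have [b [alpha [_ _ GE]]] := kernel_basis kerC rk.
have [P cardP PE] := row_patterns kerL GE.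
have [nonzero inj _] := kerC.
pose o1 : 'I_3 := lift ord0 ord0; pose o2 : 'I_3 := ord_max.
have sum3 (F : 'I_3 -> R) : (\sum_t F t = F ord0 + F o1 + F o2)%R.
  by rewrite !big_ord_recl big_ord0 addr0 addrA; congr (_ + _ + F _)%R; apply: val_inj.
have coef := small_coefficients kerL (ltnW L5) GE.
have P6 : 5 < #|P| by rewrite cardP.
have /fin_all_exists2[a a_small aE] j : exists2 a : int * int * int,
    a \in triples [:: -1; 0; 1]%R &
    [/\ alpha j ord0 = a.1.1%:~R, alpha j o1 = a.1.2%:~R & alpha j o2 = a.2%:~R]%R.
  have [[[x sx ax] [y sy ay]] [z sz az]] := (coef j ord0, coef j o1, coef j o2).
  by exists (x, y, z); first exact: (allpairs_f pair (allpairs_f pair sx sy) sz).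
pose trip (p : {ffun 'I_3 -> bool}) := (p ord0, p o1, p o2).
have formE j p : ((linear_form (a j) (trip p))%:~R = \sum_t alpha j t * (p t)%:R)%R.
  have [e0 e1 e2] := aE j; rewrite sum3 e0 e1 e2 /linear_form /trip /=.
  by rewrite !rmorphD !rmorphMn /= !mulr_natr.
have a_inj : {in C &, injective a}.
  move=> j j' Cj Cj' eq_a; apply: inj => // i; apply: (@natr_bool_inj R).
  have [[e0 e1 e2] [f0 f1 f2]] := (aE j, aE j').
  by rewrite !GE !sum3 e0 e1 e2 f0 f1 f2 eq_a.
have a_nz j : j \in C -> a j == (0, 0, 0)%R = false.
  case/nonzero=> i Gij; apply/negP=> /eqP a0; move: Gij.
  suff /(@natr_bool_inj _ _ false)-> : ((G i j)%:R = 0%:R :> R)%R by [].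
  by have [e0 e1 e2] := aE j; rewrite GE sum3 e0 e1 e2 a0 /= !mul0r !addr0.
have common j j' : 5 < count (predI (zero_one_on (a j)) (zero_one_on (a j')))
    (triples [:: false; true]).
  have trip_inj : injective trip.
    move=> p q [e0 e1 e2]; apply/ffunP=> -[[|[|[|t]]] ltt] //.
    - by rewrite (_ : Ordinal _ = ord0) //; apply: val_inj.
    - by rewrite (_ : Ordinal _ = o1) //; apply: val_inj.
    - by rewrite (_ : Ordinal _ = o2) //; apply: val_inj.
  apply: (leq_trans P6); rewrite cardE -(size_map trip) -size_filter.
  apply: uniq_leq_size; first by rewrite map_inj_uniq ?enum_uniq.
  move=> q /mapP[p]; rewrite mem_enum => Pp ->{q}; rewrite mem_filter.
  have zo k : zero_one_on (a k) (trip p).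
    have [v Ev] := PE k p Pp; rewrite /zero_one_on (_ : linear_form _ _ = v%:R)%R.
      by case: v {Ev}.
    by apply: (@intr_inj R); rewrite formE Ev rmorph_nat.
  rewrite /= !zo /=; have bool2 v : v \in [:: false; true] by case: v.
  exact: (allpairs_f pair (allpairs_f pair (bool2 _) (bool2 _)) (bool2 _)).
have extra j j' : j \in C -> j' \in C ->
    [|| a j \in coordinate_forms, a j' \in coordinate_forms | j == j'].
  move=> Cj Cj'.
  have /allP/(_ _ (a_small j))/allP/(_ _ (a_small j')) := unique_extra_form.
  by rewrite !a_nz //= leqNgt common orbF (inj_in_eq a_inj).
have sizeC : #|C| = size [seq a j | j <- enum C] by rewrite size_map -cardE.
have uniqC : uniq [seq a j | j <- enum C].
  by rewrite map_inj_in_uniq ?enum_uniq // => j j'; rewrite !mem_enum; apply: a_inj.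
rewrite sizeC.
have [/allP simple | /allPn[j]] := boolP (all (fun j => a j \in coordinate_forms) (enum C)).
  rewrite (leq_trans (uniq_leq_size uniqC (s2 := coordinate_forms) _)) //.
  by move=> _ /mapP[j Cj ->]; apply: simple.
rewrite mem_enum => Cj /negPf nsj.
apply: (uniq_leq_size uniqC (s2 := a j :: coordinate_forms)) => _ /mapP[j' + ->].
rewrite mem_enum inE => Cj'; have := extra j j' Cj Cj'; rewrite nsj /=.
by case: eqP => [->|]; rewrite ?eqxx ?orbT // orbF => _ ->; rewrite orbT.
Qed.

(** * Four columns: three bicliques or an induced 8-cycle *)

(** If no row contains just [a] and [c], then the relation forces [a <= d] and
    [c <= b], with [d - a = b - c]: the three columns [a], [c] and [d - a]
    generate all four. *)
Lemma bp_le3_missing_row n m (G : bigraph n m) (a b c d : 'I_m) :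
    column_kernel G [set a; b; c; d] -> a != b -> c != d ->
    [disjoint [set a; b] & [set c; d]] ->
    (forall i, G i a + G i b = G i c + G i d) ->
    (forall i, ~~ [&& G i a, G i c, ~~ G i b & ~~ G i d]) ->
  bp G <= 3.
Proof.
move=> kerC neq_ab neq_cd /pred0P disj rel missing.
have neq_of x y : x \in [set a; b] -> y \in [set c; d] -> (x == y) = false.
  by move=> abx cdy; apply/eqP=> eq_xy; have := disj x; rewrite /= abx eq_xy cdy.
have [ac ad bc bd] : [/\ a == c = false, a == d = false, b == c = false & b == d = false].
  by split; apply: neq_of; rewrite !inE eqxx ?orbT.
pose A (t : 'I_3) := nth set0
  [:: [set i | G i a]; [set i | G i c]; [set i | G i d && ~~ G i a]] t.
pose B (t : 'I_3) := nth set0 [:: [set a; d]; [set c; b]; [set b; d]] t.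
rewrite -[3]card_ord -cardsT.
apply: (bp_le_kernel (A := A) (B := B) kerC) => i j.
rewrite (eq_bigl xpredT) => [|t]; last by rewrite inE.
rewrite !big_ord_recl big_ord0 /A /B /= !inE -!orbA => Cj.
have := missing i; have := rel i.
case/or4P: Cj => /eqP->; rewrite ?eqxx ?ac ?ad ?bc ?bd ?(negPf neq_ab) ?(negPf neq_cd)
  ?[b == a]eq_sym ?[c == a]eq_sym ?[d == a]eq_sym ?[c == b]eq_sym ?[d == b]eq_sym
  ?[d == c]eq_sym ?ac ?ad ?bc ?bd ?(negPf neq_ab) ?(negPf neq_cd) /=.
all: by case: (G i a) (G i b) (G i c) (G i d) => [] [] [] [].
Qed.

(** Four columns tied by [a + b = c + d]: either each of the four rows meeting
    both sides of this relation once occurs, and they close an octagon, or some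
    such row is missing. *)
Lemma octagon_of_relation n m (G : bigraph n m) L (a b c d : 'I_m) :
    column_kernel G [set a; b; c; d] -> column_kernel (transpose G) L ->
    a != b -> c != d ->
    [disjoint [set a; b] & [set c; d]] ->
    (forall i, G i a + G i b = G i c + G i d) ->
    3 < bp G ->
  exists x y, [/\ octagon G x y, forall t, x t \in L
                & forall t, y t \in [set a; b; c; d]].
Proof.
move=> kerC [_ _ copy] neq_ab neq_cd disj rel bpG.
have row u v w z : [set u; v; w; z] = [set a; b; c; d] -> u != v -> w != z ->
    [disjoint [set u; v] & [set w; z]] ->
    (forall i, G i u + G i v = G i w + G i z) ->
    exists2 i, i \in L & [&& G i u, G i w, ~~ G i v & ~~ G i z].
  move=> eqC uv wz dj uvwz.
  have /existsP[i Ei] : [exists i, [&& G i u, G i w, ~~ G i v & ~~ G i z]].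
    apply: contraLR bpG => /existsPn noi; rewrite -leqNgt.
    by apply: (bp_le3_missing_row (a := u) (b := v) (c := w) (d := z)); rewrite ?eqC.
  have Giu : G i u by case/and4P: Ei.
  have [i' Li' eqi] := copy u i Giu; exists i' => //.
  by rewrite /transpose in eqi; rewrite -!eqi.
have neq_ba : b != a by rewrite eq_sym.
have neq_dc : d != c by rewrite eq_sym.
have [|||x0 Lx0 /and4P[x0a x0d /negPf x0b /negPf x0c]] := row a b d c _ neq_ab neq_dc.
- by rewrite setUAC.
- by rewrite [in X in [disjoint _ & X]]setUC.
- by move=> i; rewrite rel addnC.
have [|||x1 Lx1 /and4P[x1a x1c /negPf x1b /negPf x1d]] := row a b c d _ neq_ab neq_cd.
- by [].
- by [].
- by [].
have [|||x2 Lx2 /and4P[x2b x2c /negPf x2a /negPf x2d]] := row b a c d _ neq_ba neq_cd.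
- by rewrite [[set b; a]]setUC.
- by rewrite [[set b; a]]setUC.
- by move=> i; rewrite -rel addnC.
have [|||x3 Lx3 /and4P[x3b x3d /negPf x3a /negPf x3c]] := row b a d c _ neq_ba neq_dc.
- by rewrite setUAC [[set b; a]]setUC.
- by rewrite [[set b; a]]setUC [[set d; c]]setUC.
- by move=> i; rewrite addnC rel addnC.
exists (fun t => nth x0 [:: x0; x1; x2; x3] t).
exists (fun t => nth a [:: a; c; b; d] t).
split=> [s t | t | t].
- case: s => [[|[|[|[|s]]]] lts] //; case: t => [[|[|[|[|t]]]] ltt] //=;
    by rewrite ?x0a ?x0b ?x0c ?x0d ?x1a ?x1b ?x1c ?x1d
      ?x2a ?x2b ?x2c ?x2d ?x3a ?x3b ?x3c ?x3d.
- by case: t => [[|[|[|[|t]]]] ltt].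
by case: t => [[|[|[|[|t]]]] ltt]; rewrite //= !inE eqxx ?orbT.
Qed.

(** A relation with a single column on one side would save a biclique. *)
Lemma octagon_of_balance n m (G : bigraph n m) L C (X Y : {set 'I_m}) :
    column_kernel G C -> column_kernel (transpose G) L -> #|C| = 4 ->
    X \subset C -> Y \subset C -> [disjoint X & Y] -> X != set0 -> Y != set0 ->
    (forall i, \sum_(j in X) G i j = \sum_(j in Y) G i j) ->
    3 < bp G ->
  exists x y, [/\ octagon G x y, forall t, x t \in L & forall t, y t \in C].
Proof.
move=> kerC kerL C4 XC YC disj X0 Y0 bal bpG.
have two (Z W : {set 'I_m}) : Z \subset C -> W \subset C -> [disjoint Z & W] ->
    (forall i, \sum_(j in Z) G i j = \sum_(j in W) G i j) -> Z != set0 ->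
    1 < #|Z|.
  move=> ZC WC dj balZW Z0; rewrite ltn_neqAle card_gt0 Z0 andbT.
  apply: contraL bpG => /eqP/esym/eqP/cards1P[k Ek]; rewrite -leqNgt -ltnS -C4.
  have Ck : k \in C by rewrite (subsetP ZC) // Ek set11.
  apply: (@bp_lt_columns _ _ G C k W) => // [|i].
    by rewrite subsetD1 WC /=; apply: contraL dj => Wk;
      apply/pred0Pn; exists k; rewrite /= Ek set11.
  by rewrite -balZW Ek big_set1.
have X2 := two X Y XC YC disj bal X0.
have Y2 : 1 < #|Y|.
  by apply: (two Y X) => //; rewrite disjoint_sym.
have cardXY : #|X :|: Y| = #|X| + #|Y|.
  by rewrite -cardsUI (disjoint_setI0 disj) cards0 addn0.
have XYC : X :|: Y \subset C by rewrite subUset XC.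
have XY4 : #|X| + #|Y| <= 4 by rewrite -cardXY -C4 subset_leq_card.
have /eqP/cards2P[a [b [neq_ab EX]]] : #|X| = 2 by lia.
have /eqP/cards2P[c [d [neq_cd EY]]] : #|Y| = 2 by lia.
have EC : [set a; b; c; d] = C.
  by apply/eqP; rewrite -setUA -EX -EY eqEcard XYC C4 cardXY; lia.
rewrite -EC in kerC *; apply: octagon_of_relation => //; first by rewrite -EX -EY.
by move=> i; have := bal i; rewrite EX EY !big_setU1 ?inE //= !big_set1.
Qed.

(** The fourth column is a combination of three basis columns with coefficients
    in [{-1,0,1}]; moving the negative terms to its side gives two disjoint sets
    of columns with the same sum. *)
Lemma octagon_of_four_columns (R : realType) n m (G : bigraph n m) L C :
    \rank (reduced_adj R G) = 3 ->
    column_kernel G C -> column_kernel (transpose G) L -> #|C| = 4 ->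
    3 < bp G ->
  exists x y, [/\ octagon G x y, forall t, x t \in L & forall t, y t \in C].
Proof.
move=> rk kerC kerL C4 bpG.
have L4 : 3 < #|L| by rewrite -(bp_transpose G) in bpG; apply: leq_trans (bp_le_columns kerL).
have [b [alpha [b_inj Cb GE]]] := kernel_basis kerC rk.
have alpha_small := small_coefficients kerL L4 GE.
have /subsetPn[d Cd bd] : ~~ (C \subset b @: [set: 'I_3]).
  apply/negP=> /subset_leq_card; rewrite C4 card_imset // cardsT card_ord.
  by [].
pose pos := [set t | alpha d t == 1%R]; pose neg := [set t | alpha d t == (-1)%R].
have bC (S : {set 'I_3}) : b @: S \subset C by apply/subsetP=> _ /imsetP[t _ ->].
have notd (S : {set 'I_3}) : d \notin b @: S.
  by apply: contra bd => /imsetP[t _ ->]; rewrite imset_f.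
have bal i : \sum_(j in d |: b @: neg) G i j = \sum_(j in b @: pos) G i j.
  rewrite big_setU1 //= !big_imset /=; try by move=> ? ? _ _; apply: b_inj.
  apply/eqP; rewrite -(eqr_nat R) natrD !natr_sum GE.
  rewrite [X in (_ + X)%R]big_mkcond [X in _ == X]big_mkcond -big_split /=.
  apply/eqP; apply: eq_bigr => t _; rewrite !inE.
  have [neq1 neq2] : (-1 == 1 :> R)%R = false /\ (1 == -1 :> R)%R = false.
    by split; apply/eqP; lra.
  have [neq3 neq4] : (0 == 1 :> R)%R = false /\ (0 == -1 :> R)%R = false.
    by split; apply/eqP; lra.
  have [c] := alpha_small d t; rewrite !inE => /or3P[]/eqP-> ->.
  - by rewrite mulrN1z eqxx neq1 mulN1r addNr.
  - by rewrite mulr0z neq3 neq4 mul0r add0r.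
  by rewrite mulr1z eqxx neq2 mul1r addr0.
apply: (octagon_of_balance (X := d |: b @: neg) (Y := b @: pos)) => //.
- by rewrite subUset sub1set Cd bC.
- rewrite -setI_eq0; apply/eqP/setP=> j; rewrite !inE; apply/andP=> -[].
  case/orP=> [/eqP-> | /imsetP[t tneg ->]]; first by rewrite (negPf (notd _)).
  rewrite mem_imset // inE => /eqP t1; move: tneg; rewrite inE t1 => /eqP; lra.
- by apply/set0Pn; exists d; rewrite setU11.
apply/eqP=> pos0; have [nonzero _ _] := kerC; have [i Gid] := nonzero d Cd.
by have := bal i; rewrite pos0 big_set0 big_setU1 //= Gid.
Qed.

(** * Rank three *)

Lemma kernel_sides_le4 (R : realType) n m (G : bigraph n m) V :
    \rank (reduced_adj R G) = 3 -> is_kernel G V ->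
  #|left_side V| <= 4 \/ #|right_side V| <= 4.
Proof.
move=> rk kerV; have [|L5] := leqP #|left_side V| 4; [by left | right].
by apply: (column_kernel_le4 rk (left_side_kernel kerV) (right_side_kernel kerV)).
Qed.

Lemma bp_le_sides n m (G : bigraph n m) V : is_kernel G V ->
  bp G <= #|left_side V| /\ bp G <= #|right_side V|.
Proof.
move=> kerV; rewrite -{1}bp_transpose.
by split; apply: bp_le_columns; [apply: left_side_kernel | apply: right_side_kernel].
Qed.

Lemma bp_le4_of_rank3 (R : realType) n m (G : bigraph n m) :
  \rank (reduced_adj R G) = 3 -> bp G <= 4.
Proof.
move=> rk; have [V kerV] := is_kernel_exists G.
have [leL leR] := bp_le_sides kerV.
by have [] := kernel_sides_le4 rk kerV; apply: leq_trans.
Qed.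

Lemma octagon_of_bp4 (R : realType) n m (G : bigraph n m) V :
    \rank (reduced_adj R G) = 3 -> is_kernel G V -> 3 < bp G ->
  has_induced_cycle G V 8.
Proof.
move=> rk kerV bpG; apply/octagonP; have [leL leR] := bp_le_sides kerV.
have kerL := left_side_kernel kerV; have kerR := right_side_kernel kerV.
have [L4 | R4] := kernel_sides_le4 rk kerV.
  have [] := @octagon_of_four_columns R _ _ (transpose G) (right_side V) (left_side V).
  - by rewrite rank_transpose.
  - by [].
  - by [].
  - by apply/eqP; rewrite eqn_leq L4 (leq_trans bpG).
  - by rewrite bp_transpose.
  move=> x [y [oct Rx Ly]]; exists (y \o @ord_pred 4), x.
  by split=> [|a|b]; [apply: octagon_transpose | apply: Ly | apply: Rx].
apply: (octagon_of_four_columns rk kerR kerL _ bpG).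
by apply/eqP; rewrite eqn_leq R4 (leq_trans bpG).
Qed.

Theorem corollary4 (R : realType) (n m : nat) (G : bigraph n m)
    (hrank : \rank (reduced_adj R G) = 3) :
  ((3 <= bp G <= 4) /\ (2 <= bc G <= 4)) /\
  (forall V : {set 'I_n + 'I_m}, is_kernel G V ->
     [/\ (bp G = 4 /\ bc G = 4) <-> has_induced_cycle G V 8,
         ~ is_bisected_hexagon G V -> bp G = bc G
       & #|left_side V| <= 4 \/ #|right_side V| <= 4]).
Proof.
have bp3 : 3 <= bp G by rewrite -hrank rank_le_bp.
have bp4 : bp G <= 4 := bp_le4_of_rank3 hrank.
have bc_bp : bc G <= bp G := bc_le_bp G.
have bc2 : 2 <= bc G.
  by rewrite ltnNge; apply/negP=> bc1; have := bp_le_bc bc1; lia.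
split=> [|V kerV]; first by rewrite bp3 bp4 bc2 (leq_trans bc_bp).
have cycle_bc : has_induced_cycle G V 8 -> 4 <= bc G.
  by case/octagonP=> x [y [oct _ _]]; apply: octagon_bc oct.
have bp4_cycle : 3 < bp G -> has_induced_cycle G V 8 := octagon_of_bp4 hrank kerV.
split; last exact: kernel_sides_le4 hrank kerV.
  by split=> [[bpE _] | /cycle_bc bc4]; [apply: bp4_cycle; rewrite bpE | lia].
move=> not_hexagon; have bc_neq2 : bc G <> 2.
  by move=> bcE; apply: not_hexagon; apply: bc2_bisected_hexagon.
by have [/bp4_cycle/cycle_bc | ] := ltnP 3 (bp G); lia.
Qed.
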